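(* For a positive integer $n$, let $\mathcal{M}_e(n)$ (resp. $\mathcal{M}_o(n)$) be the number of partitions of $n$ with an even (resp. odd) number of missing integers. Then for every positive integer $n$, \[ \mathcal{M}_e(n)-\mathcal{M}_o(n)\equiv \begin{cases} 0 \pmod 3, & \text{if } n \text{ is not a square},\\ 1 \pmod 3, & \text{if } n \text{ is an odd square},\\ 2 \pmod 3, & \text{if } n \text{ is an even square.} \end{cases} \]
   Context: For a partition $\pi$ with largest part $L$, a missing integer of $\pi$ is a positive integer less than $L$ that does not occur as a part of $\pi$. *)

(* Defs.v *)
From HB Require Import structures.
From mathcomp Require Import all_boot.

Set Implicit Arguments.
Unset Strict Implicit.
Unset Printing Implicit Defensive.

(* Partitions are written with their parts in nonincreasing order. *)
Definition is_partition (n : nat) (s : seq nat) : bool :=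
  [&& sorted geq s, all (leq 1) s & sumn s == n].

Record intpart (n : nat) := IntPart {
  parts :> seq nat;
  partsP : is_partition n parts
}.

HB.instance Definition _ n := [isSub for @parts n].
HB.instance Definition _ n := [Countable of intpart n by <:].

(* There are finitely many partitions of n: each has at most n parts, all of
   them at most n, so it embeds in the finite type of sequences of length at
   most n over {0, ..., n}. *)
Definition intpart_code n (p : intpart n) : n.-bseq 'I_n.+1 :=
  insub_bseq n (map inord (parts p)).

Definition intpart_decode n (b : n.-bseq 'I_n.+1) : option (intpart n) :=
  insub (map val b).

Lemma leq_mem_sumn (s : seq nat) x : x \in s -> x <= sumn s.
Proof.
elim: s => //= y s IHs; rewrite inE => /orP[/eqP->|/IHs le_xs].
  exact: leq_addr.
exact: leq_trans le_xs (leq_addl _ _).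
Qed.

Lemma leq_size_sumn (s : seq nat) : all (leq 1) s -> size s <= sumn s.
Proof.
by elim: s => //= y s IHs /andP[y_gt0 /IHs le_s]; rewrite -add1n leq_add.
Qed.

Lemma intpart_codeK n : pcancel (@intpart_code n) (@intpart_decode n).
Proof.
move=> p; have /and3P[_ pos_p /eqP sum_p] := partsP p.
rewrite /intpart_decode /intpart_code /insub_bseq insubdK; last first.
  by rewrite unfold_in /= size_map -{2}sum_p leq_size_sumn.
suff ->: map val (map (@inord n) p) = p by exact: valK.
rewrite -map_comp -[RHS]map_id; apply/eq_in_map => x x_p /=.
by rewrite inordK // ltnS -sum_p leq_mem_sumn.
Qed.

HB.instance Definition _ n : isFinite (intpart n) := PCanIsFinite (@intpart_codeK n).

Definition largest_part (s : seq nat) : nat := \max_(i <- s) i.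

Definition missing (s : seq nat) : seq nat :=
  [seq m <- index_iota 1 (largest_part s) | m \notin s].

Definition M_e (n : nat) : nat := #|[set p : intpart n | ~~ odd (size (missing p))]|.

Definition M_o (n : nat) : nat := #|[set p : intpart n | odd (size (missing p))]|.

Definition is_square (n : nat) : Prop := exists m : nat, n = m ^ 2.

(* Main.v *)
(* Write (a)_L for the q-shifted factorial (a; q)_L. Attaching the sign
   (-1)^(number of missing integers) to each partition and sorting by the
   largest part L + 1, the generating function of M_e - M_o is
     1 + sum_L q^(L+1) / (1 - q^(L+1)) prod_(i <= L) (q^i / (1 - q^i) - 1),
   and 2 q^i - 1 = - (1 + q^i) modulo 3 turns it into
     1 + q H_1,  H_k = sum_L (- q^k)^L (- q^k)_L / (q^k)_(L+1).
   Telescoping gives the Rogers-Fine recurrence H_k = 1 - q^(2k+1) H_(k+1),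
   hence q H_1 = sum_(j >= 0) (-1)^j q^((j+1)^2). All series are truncated: q
   is a nilpotent element of a ring, finally X in F_3[X]/(X^(n+1)). *)
Require Import Defs.
From mathcomp Require Import all_boot all_order all_algebra.
From mathcomp Require Import ring zify.
From mathcomp Require Import qpoly.

Set Implicit Arguments.
Unset Strict Implicit.
Unset Printing Implicit Defensive.

Import GRing.Theory.
Local Open Scope ring_scope.

(** * The Rogers-Fine recurrence for a nilpotent [q] *)

Section RogersFine.

Variables (A : comNzRingType) (q : A) (N : nat).
Hypothesis qN0 : q ^+ N = 0.

(* The inverse of [1 - q ^+ i] when [0 < i]; [q ^+ N = 0] makes the sum finite. *)
Definition geo i : A := \sum_(m < N) q ^+ i ^+ m.

Lemma expq_eq0 n : (N <= n)%N -> q ^+ n = 0.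
Proof. by move=> /subnKC <-; rewrite exprD qN0 mul0r. Qed.

Lemma geoP i : (0 < i)%N -> (1 - q ^+ i) * geo i = 1.
Proof.
move=> i_gt0; rewrite -[1 - _]opprB mulNr -subrX1 -exprM.
by rewrite (@expq_eq0 (i * N)%N) ?leq_pmull // sub0r opprK.
Qed.

(* The [n]-th term of [H_k]. *)
Definition rf k n : A :=
  (- q ^+ k) ^+ n * \prod_(i < n) (1 + q ^+ (k + i)) * \prod_(i < n.+1) geo (k + i).

(* [- q ^+ k * rf_tail k n] is the rational (WZ) certificate of the recurrence
   for [H_k] at [n.+1], found by solving for a multiple of [rf k n.+1]. *)
Definition rf_tail k n : A :=
  (- q ^+ k) ^+ n * \prod_(i < n) (1 + q ^+ (k.+1 + i))
  * \prod_(i < n.+1) geo (k + i).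

Lemma expNq_eq0 k n : (0 < k)%N -> (N <= n)%N -> (- q ^+ k) ^+ n = 0.
Proof.
move=> k_gt0 le_Nn; rewrite exprNn -exprM expq_eq0 ?mulr0 //.
exact: leq_trans le_Nn (leq_pmull _ k_gt0).
Qed.

Lemma rf_eq0 k n : (0 < k)%N -> (N <= n)%N -> rf k n = 0.
Proof. by move=> k_gt0 le_Nn; rewrite /rf expNq_eq0 ?mul0r. Qed.

Lemma rf_tail_eq0 k n : (0 < k)%N -> (N <= n)%N -> rf_tail k n = 0.
Proof. by move=> k_gt0 le_Nn; rewrite /rf_tail expNq_eq0 ?mul0r. Qed.

Lemma rf_step k n : (0 < k)%N ->
  rf k n.+1 + q ^+ k.*2.+1 * rf k.+1 n
  = q ^+ k * (rf_tail k n.+1 - rf_tail k n).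
Proof.
move=> k_gt0; rewrite /rf /rf_tail.
have shift (F : nat -> A) m :
    \prod_(i < m.+1) F (k + i)%N = F k * \prod_(i < m) F (k.+1 + i)%N.
  rewrite big_ord_recl addn0; congr (_ * _).
  by apply: eq_bigr => i _; rewrite /= /bump leq0n addnA addn1.
rewrite !(shift geo) (shift (fun m => 1 + q ^+ m)) !big_ord_recr /=.
have := geoP k_gt0; have := geoP (i := (k.+1 + n)%N) isT.
have -> : (- q ^+ k.+1) ^+ n = (- q ^+ k) ^+ n * q ^+ n.
  by rewrite exprSr -mulNr exprMn.
have -> : q ^+ (k.+1 + n) = q ^+ k * q ^+ n * q by rewrite addSn exprSr exprD.
have -> : q ^+ k.*2.+1 = q ^+ k * q ^+ k * q by rewrite exprSr -addnn exprD.
rewrite [(- q ^+ k) ^+ n.+1]exprSr.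
move: (q ^+ k) (q ^+ n) ((- _) ^+ n) (geo k) (geo _) => x y s a b hb ha.
move: (\prod_(i < n) _) (\prod_(i < n) _) => G P.
(* Inserting the factors [(1 - x) * a] and [(1 - x * y * q) * b], both equal to 1, gives every term
   the common factor [a * G * b]; what remains is a polynomial identity. *)
transitivity (s * (- x) * ((1 + x) * P) * (a * (G * b))
              + x * x * q * (s * y * P * (G * b)) * ((1 - x) * a)).
  by rewrite ha mulr1.
transitivity (x * (s * (- x) * (P * (1 + x * y * q)) * (a * (G * b))
  - s * P * (a * G) * ((1 - x * y * q) * b))); last by rewrite hb mulr1.
by ring.
Qed.

(** Telescoping of [rf_step]; the 1 comes from the first term, as [geo k = 1 + q ^+ k * geo k]. *)
Lemma rf_partial_sum k n : (0 < k)%N ->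
  \sum_(i < n.+1) rf k i + q ^+ k.*2.+1 * (\sum_(i < n) rf k.+1 i)
  = 1 + q ^+ k * rf_tail k n.
Proof.
move=> k_gt0; elim: n => [|n IHn].
  rewrite big_ord_recr !big_ord0 /= add0r mulr0 addr0 /rf /rf_tail.
  rewrite !expr0 !big_ord0 !mul1r big_ord_recr big_ord0 /= mul1r addn0.
  by rewrite -[in RHS](geoP k_gt0); ring.
rewrite big_ord_recr /= [\sum_(i < n.+1) rf k.+1 i]big_ord_recr /=.
by rewrite mulrDr addrACA IHn rf_step //; ring.
Qed.

(** This is H_k: for [0 < k] all terms from [N] on vanish. *)
Definition theta k : A := \sum_(n < N) rf k n.

Lemma theta_rec k : (0 < k)%N -> theta k = 1 - q ^+ k.*2.+1 * theta k.+1.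
Proof.
move=> k_gt0; apply/(canRL (addrK _)).
have := rf_partial_sum N k_gt0.
by rewrite big_ord_recr /= rf_eq0 // rf_tail_eq0 // mulr0 !addr0.
Qed.

Lemma theta1 : q * theta 1 = \sum_(j < N) (-1) ^+ j * q ^+ (j.+1 ^ 2).
Proof.
(* Each use of the recurrence, at [k = J.+1], moves the exponent from one square to the next; at
   [J = N] nilpotency kills the remainder. *)
have iter J : q * theta 1 = \sum_(j < J) (-1) ^+ j * q ^+ (j.+1 ^ 2)
                            + (-1) ^+ J * q ^+ (J.+1 ^ 2) * theta J.+1.
  elim: J => [|J ->]; first by rewrite big_ord0 add0r mul1r.
  rewrite big_ord_recr /= -addrA; congr (_ + _).
  rewrite [theta J.+1]theta_rec //.
  have -> : (J.+2 ^ 2 = J.+1 ^ 2 + J.+1.*2.+1)%N by lia.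
  rewrite exprD [(-1) ^+ J.+1]exprS; move: (q ^+ _) (q ^+ _) (_ ^+ J) => x y s.
  by ring.
rewrite (iter N) [q ^+ (N.+1 ^ 2)]expq_eq0 ?mulr0 ?mul0r ?addr0 //.
by lia.
Qed.

End RogersFine.

(** * Partitions as plain sequences, and their gaps *)

Definition partitions n : seq (seq nat) := [seq val p | p <- enum {: intpart n}].

Lemma mem_partitions n s : (s \in partitions n) = is_partition n s.
Proof.
apply/mapP/idP => [[p _ ->]|part_s]; first exact: partsP.
by exists (IntPart part_s); rewrite ?mem_enum.
Qed.

Lemma partitions_uniq n : uniq (partitions n).
Proof. by rewrite map_inj_uniq ?enum_uniq //; apply: val_inj. Qed.

Lemma is_partition_cons n m s : is_partition n (m :: s) =
  [&& (0 < m <= n)%N, is_partition (n - m) s & all (geq m) s].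
Proof.
rewrite /is_partition /= path_sortedE; last by move=> x y z /= ? ?; lia.
by case: (all (geq m) s); case: (sorted geq s); case: (all _ s);
  rewrite /= ?andbF ?andbT //; lia.
Qed.

Lemma largest_part_head n s : is_partition n s -> largest_part s = head 0%N s.
Proof.
case: s => [|m s]; first by rewrite /largest_part big_nil.
rewrite is_partition_cons => /and3P[_ _ /allP le_sm].
rewrite /largest_part big_cons; apply/maxn_idPl.
by apply/bigmax_leqP_seq => i /le_sm.
Qed.

Lemma head_leq n s : is_partition n s -> (head 0%N s <= n)%N.
Proof. by case: s => [|m s] //; rewrite is_partition_cons => /and3P[/andP[]]. Qed.

Lemma all_geq_head n s L : is_partition n s -> all (geq L) s = (head 0%N s <= L)%N.
Proof.
case: s => [|m s] //.
rewrite is_partition_cons /= => /and3P[_ _ /allP le_sm].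
apply/andb_idr => le_mL; apply/allP => i /le_sm /= le_im.
exact: leq_trans le_im le_mL.
Qed.

(** The bound [L] is a parameter, not read off [s] as in [missing], so that it can grow by one while
    [s] stays fixed. *)
Definition gaps L (s : seq nat) := count [pred m | m \notin s] (iota 1 L).

Lemma gapsS L s : gaps L.+1 s = (gaps L s + (L.+1 \notin s))%N.
Proof. by rewrite /gaps -{1}(addn1 L) iotaD count_cat /= add1n addn0. Qed.

Lemma gaps_cons L s : gaps L (L.+1 :: s) = gaps L s.
Proof.
apply: eq_in_count => m; rewrite mem_iota /= inE => m_le.
by rewrite -[m == _]negbK neq_ltn; case: ltnP => //; lia.
Qed.

Lemma missing_gaps n L s : is_partition n s -> head 0%N s = L.+1 ->
  size (missing s) = gaps L s.
Proof.
by move=> ps hs; rewrite /missing size_filter (largest_part_head ps) hs /index_iota subn1.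
Qed.

(** * Signed counts sorted by largest part *)

Section GeneratingFunction.

Variable A : comNzRingType.

(* Integers above the largest part, up to [L], count as gaps here. *)
Definition signed L n : A :=
  \sum_(s <- partitions n | (head 0 s <= L)%N) (-1) ^+ gaps L s.

Definition signed_head L n : A :=
  \sum_(s <- partitions n | head 0%N s == L.+1) (-1) ^+ gaps L s.

Lemma notin_partition n s m : is_partition n s -> (head 0%N s < m)%N -> m \notin s.
Proof.
move=> ps lt_m; apply/negP => m_s.
have := all_geq_head (head 0%N s) ps; rewrite leqnn => /allP/(_ m m_s) /=.
by rewrite leqNgt lt_m.
Qed.

Lemma head_in_partition s m : head 0%N s = m.+1 -> m.+1 \in s.
Proof. by case: s => //= x s ->; rewrite mem_head. Qed.

(** If the head is [L.+1], the new bound adds no gap; otherwise [L.+1] is itself a new gap and flips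
    the sign. *)
Lemma signedS L n : signed L.+1 n = signed_head L n - signed L n.
Proof.
rewrite /signed (bigID (fun s => head 0%N s == L.+1)) /=; congr (_ + _).
  apply: eq_big => [s|s /andP[_ /eqP hs]]; last first.
    by rewrite gapsS head_in_partition // addn0.
  by apply/andb_idl => /eqP->.
rewrite -sumrN big_seq_cond [RHS]big_seq_cond; apply: eq_big => [s|s].
  by congr (_ && _); lia.
rewrite mem_partitions => /andP[ps /andP[le_s ne_s]].
rewrite gapsS (notin_partition ps); last by lia.
by rewrite addn1 exprS mulN1r.
Qed.

(* Delete one copy of the largest part [L.+1]. *)
Lemma signed_headE L n : signed_head L n =
  if (L < n)%N then signed L (n - L.+1) + signed_head L (n - L.+1) else 0.
Proof.
case: ltnP => [lt_Ln|le_nL]; last first.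
  rewrite /signed_head big_seq_cond big1 // => s /andP[].
  rewrite mem_partitions; case: s => // m s.
  by rewrite is_partition_cons => /and3P[le_m _ _] /=; lia.
rewrite /signed_head -big_filter.
have permE : perm_eq [seq s <- partitions n | head 0%N s == L.+1]
    (map (cons L.+1) [seq s <- partitions (n - L.+1) | (head 0 s <= L.+1)%N]).
  apply: uniq_perm; first by rewrite filter_uniq ?partitions_uniq.
    rewrite map_inj_uniq ?filter_uniq ?partitions_uniq //.
    by move=> s t [].
  move=> s; rewrite mem_filter mem_partitions; apply/idP/mapP.
    case: s => // m s /= /andP[/eqP-> ].
    rewrite is_partition_cons => /and3P[_ ps le_s]; exists s => //.
    by rewrite mem_filter mem_partitions ps -(all_geq_head _ ps) le_s.
  case=> t; rewrite mem_filter mem_partitions => /andP[le_t pt] -> /=.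
  by rewrite eqxx is_partition_cons pt (all_geq_head _ pt) le_t lt_Ln.
(* The deleted part may have been the only copy of [L.+1] or not: the new head is at most [L], or
   still [L.+1]. *)
rewrite (perm_big _ permE) big_map big_filter (bigID (fun s => (head 0 s <= L)%N)) /=.
congr (_ + _); apply: eq_big => [s|s _]; rewrite ?gaps_cons //; lia.
Qed.

Lemma signed0 n : signed 0 n = (n == 0%N)%:R.
Proof.
rewrite /signed -big_filter.
have permE : perm_eq [seq s <- partitions n | (head 0 s <= 0)%N]
                            (if n == 0%N then [:: [::]] else [::]).
  apply: uniq_perm; rewrite ?filter_uniq ?partitions_uniq //; first by case: ifP.
  move=> s; rewrite mem_filter mem_partitions; case: s => [|[|m] s].
  - by rewrite /is_partition /= eq_sym; case: eqP.
  - by rewrite is_partition_cons; case: (n == 0%N).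
  - by case: (n == 0%N).
by rewrite (perm_big _ permE); case: eqP => _; rewrite ?big_seq1 ?big_nil.
Qed.

(** Largest part 0 means the empty partition, whence the separate term; for largest part [L.+1] the
    missing integers are exactly the gaps up to [L]. *)
Lemma M_diffE N n : (n < N)%N ->
  ((M_e n)%:Z - (M_o n)%:Z)%:~R = (n == 0%N)%:R + \sum_(L < N) signed_head L n.
Proof.
move=> lt_nN; transitivity (\sum_(s <- partitions n) (-1) ^+ size (missing s) : A).
  rewrite big_map big_enum /= (bigID (fun p : intpart n => odd (size (missing p)))) /=.
  rewrite addrC rmorphB /= /M_e /M_o !cardsE -!sum1_card.
  rewrite -!pmulrn !natr_sum -sumrN.
  by congr (_ + _); apply: eq_bigr => p; rewrite -signr_odd ?unfold_in; case: odd.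
rewrite (partition_big (fun s => inord (head 0%N s) : 'I_N.+1) xpredT) //=.
have inord_head s (j : 'I_N.+1) : s \in partitions n ->
    (inord (head 0%N s) == j) = (head 0%N s == j).
  rewrite mem_partitions => /head_leq le_sn.
  by rewrite -val_eqE /= inordK // ltnS ltnW // (leq_ltn_trans le_sn).
rewrite big_ord_recl -signed0; congr (_ + _).
  rewrite /signed big_seq_cond [RHS]big_seq_cond.
  apply: eq_big => [s|s /andP[s_n]].
    by apply: andb_id2l => s_n; rewrite inord_head // leqn0.
  rewrite inord_head // => /= /eqP hs.
  move: s_n; rewrite mem_partitions => /largest_part_head.
  by rewrite hs /missing => ->.
apply: eq_bigr => L _; rewrite /signed_head big_seq_cond [RHS]big_seq_cond.
apply: eq_big => [s|s /andP[s_n]].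
  by apply: andb_id2l => s_n; rewrite inord_head.
rewrite inord_head // => /eqP hs.
by rewrite (missing_gaps (n := n) _ hs) -?mem_partitions.
Qed.

(** * Truncated generating series *)

Section Truncation.

Variables (q : A) (N : nat).
Hypothesis qN0 : q ^+ N = 0.

Definition series (f : nat -> A) : A := \sum_(n < N) f n * q ^+ n.

Lemma seriesD f g : series (fun n => f n + g n) = series f + series g.
Proof. by rewrite /series -big_split; apply: eq_bigr => n _; rewrite /= mulrDl. Qed.

Lemma series_shift f m :
  series (fun n => if (m <= n)%N then f (n - m)%N else 0) = q ^+ m * series f.
Proof.
set F := fun n : nat => (if (m <= n)%N then f (n - m)%N else 0) * q ^+ n.
(* The last [m] terms vanish because [q ^+ N = 0], the first [m] because of the test in [F]. *)
transitivity (\sum_(n < N + m) F n).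
  rewrite big_split_ord /= [X in _ + X]big1 ?addr0 // => i _.
  by rewrite /F (@expq_eq0 _ q N) ?mulr0 ?leq_addr.
rewrite addnC big_split_ord /= big1 ?add0r => [|i _]; last first.
  by rewrite /F leqNgt ltn_ord mul0r.
rewrite mulr_sumr; apply: eq_bigr => i _.
by rewrite /F leq_addr addKn exprD mulrCA.
Qed.

(** [signed_headE] becomes a linear equation for the series, solved by inverting [1 - q ^+ L.+1]. *)
Lemma series_signed_head L :
  series (signed_head L) = q ^+ L.+1 * geo q N L.+1 * series (signed L).
Proof.
have eqC : series (signed_head L)
    = q ^+ L.+1 * (series (signed L) + series (signed_head L)).
  rewrite -seriesD -series_shift.
  by apply: eq_bigr => n _; rewrite signed_headE.
rewrite -[LHS]mul1r -(@geoP _ q N qN0 L.+1) //.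
transitivity (geo q N L.+1 * (series (signed_head L)
                              - q ^+ L.+1 * series (signed_head L))); first by ring.
by rewrite {1}eqC; ring.
Qed.

Hypothesis N_gt0 : (0 < N)%N.
Hypothesis char3 : 3%:R = 0 :> A.

Lemma series_signed L : series (signed L) =
  (-1) ^+ L * \prod_(i < L) (1 + q ^+ i.+1) * \prod_(i < L) geo q N i.+1.
Proof.
elim: L => [|L IHL].
  rewrite !big_ord0 !mulr1 /series -(prednK N_gt0) big_ord_recl signed0 mul1r.
  by rewrite big1 ?addr0 // => i _; rewrite signed0 mul0r.
have -> : series (signed L.+1) = series (signed_head L) - series (signed L).
  by rewrite /series -sumrB; apply: eq_bigr => n _; rewrite signedS mulrBl.
rewrite series_signed_head !big_ord_recr /= [(-1) ^+ L.+1]exprS.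
(* Characteristic 3 enters here: with [x = q ^+ L.+1], the true factor [2x - 1] differs from
   [-(1 + x)] by [3x]. *)
transitivity (- ((1 + q ^+ L.+1) * geo q N L.+1 * series (signed L))).
  rewrite -[X in _ - X]mul1r -[X in _ - X * _](@geoP _ q N qN0 L.+1) //.
  apply/eqP; rewrite -subr_eq0; apply/eqP.
  transitivity (3%:R * (q ^+ L.+1 * geo q N L.+1 * series (signed L))).
    by ring.
  by rewrite char3 mul0r.
by rewrite IHL; ring.
Qed.

Lemma series_M_diff : series (fun n => ((M_e n)%:Z - (M_o n)%:Z)%:~R)
  = 1 + \sum_(j < N) (-1) ^+ j * q ^+ (j.+1 ^ 2).
Proof.
have rfE L : series (signed_head L) = q * rf q N 1 L.
  rewrite series_signed_head series_signed /rf expr1 [(- q) ^+ L]exprNn big_ord_recr /=.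
  by rewrite -[geo q N (1 + L)]/(geo q N L.+1) [q ^+ L.+1]exprS; ring.
rewrite -(theta1 qN0) /theta mulr_sumr.
under [in RHS]eq_bigr => L _ do rewrite -rfE.
(* The constant 1 is the series of the empty partition. *)
rewrite (_ : 1 + _ = series (signed 0) + \sum_(L < N) series (signed_head L)); last first.
  by rewrite series_signed !big_ord0 !mulr1.
rewrite [\sum_(L < N) series _]exchange_big -big_split; apply: eq_bigr => n _ /=.
by rewrite (@M_diffE N) // signed0 mulrDl mulr_suml.
Qed.

End Truncation.

End GeneratingFunction.

(** * Coefficient extraction modulo a power of X *)

Lemma coef_eq_in_qpoly (R : comNzRingType) N (f g : {poly R}) n : (n < N)%N ->
  in_qpoly 'X^N f = in_qpoly 'X^N g -> f`_n = g`_n.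
Proof.
move=> lt_nN /(congr1 val) /=; rewrite mk_monic_Xn (ltn_predK lt_nN).
rewrite -!Pdiv.RingMonic.take_poly_rmodp => /polyP/(_ n).
by rewrite !coef_take_poly lt_nN.
Qed.

Lemma M_diff_Fp n : (0 < n)%N ->
  ((M_e n)%:Z - (M_o n)%:Z)%:~R
  = \sum_(j < n.+1) (n == j.+1 ^ 2)%N%:R * (-1) ^+ j :> 'F_3.
Proof.
move=> n_gt0; set N := n.+1; pose q := in_qpoly 'X^N ('X : {poly 'F_3}).
pose D m : int := (M_e m)%:Z - (M_o m)%:Z.
have qN0 : q ^+ N = 0.
  rewrite -rmorphXn; apply/val_inj => /=.
  by rewrite mk_monic_Xn /= Pdiv.RingMonic.rmodpp // monicXn.
have char3 : 3%:R = 0 :> {poly %/ ('X^N : {poly 'F_3})}.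
  rewrite -(rmorph_nat (in_qpoly 'X^N)) -polyC_natr.
  by rewrite (_ : 3%:R = 0 :> 'F_3) ?rmorph0 //; apply/val_inj.
have := series_M_diff qN0 isT char3.
have -> : series q N (fun m => (D m)%:~R)
    = in_qpoly 'X^N (\sum_(m < N) (D m)%:~R%:P * 'X^m).
  rewrite rmorph_sum; apply: eq_bigr => m _.
  by rewrite /= rmorphM rmorphXn !rmorph_int.
have -> : 1 + \sum_(j < N) (-1) ^+ j * q ^+ (j.+1 ^ 2)
    = in_qpoly 'X^N (1 + \sum_(j < N) ((-1) ^+ j)%:P * 'X^(j.+1 ^ 2)).
  rewrite rmorphD rmorph1 rmorph_sum; congr (_ + _); apply: eq_bigr => j _.
  by rewrite /= rmorphM !rmorph_sign rmorphXn.
move=> /(coef_eq_in_qpoly (ltnSn n)); rewrite coefD coef1 !coef_sum.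
(* The constant 1 drops out as [0 < n]; on the left only the last term, [m = n], has degree [n]. *)
rewrite (gtn_eqF n_gt0) add0r big_ord_recr big1 /= => [|i _]; last first.
  by rewrite coefCM coefXn gtn_eqF ?mulr0.
rewrite add0r coefCM coefXn eqxx mulr1 => ->.
by apply: eq_bigr => j _; rewrite coefCM coefXn mulrC.
Qed.

Theorem theorem2p6 (n : nat) (n_gt0 : (0 < n)%N) :
  [/\ ~ is_square n ->
        ((M_e n)%:Z - (M_o n)%:Z = 0 %[mod 3])%Z,
      is_square n /\ odd n ->
        ((M_e n)%:Z - (M_o n)%:Z = 1 %[mod 3])%Z
    & is_square n /\ ~~ odd n ->
        ((M_e n)%:Z - (M_o n)%:Z = 2 %[mod 3])%Z].
Proof.
have eq_mod (x y : int) : x%:~R = y%:~R :> 'F_3 -> (x = y %[mod 3])%Z.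
  move=> /eqP; rewrite -subr_eq0 -rmorphB -(dvdz_pcharf (pchar_Fp (isT : prime 3))).
  by rewrite -eqz_mod_dvd => /eqP.
(* Squaring is injective, so only the index [m] contributes; its parity is opposite to that of
   [n]. *)
have square m : n = (m.+1 ^ 2)%N ->
    ((M_e n)%:Z - (M_o n)%:Z)%:~R = (-1) ^+ m :> 'F_3.
  move=> n_m; have lt_mn : (m < n.+1)%N by lia.
  rewrite M_diff_Fp // (bigD1 (Ordinal lt_mn)) //= -n_m eqxx mul1r.
  rewrite big1 ?addr0 // => j ne_jm; rewrite [X in (X == _)%:R]n_m eqn_exp2r // eqSS.
  by rewrite eq_sym -[X in _ == X]/(val (Ordinal lt_mn)) val_eqE (negPf ne_jm) mul0r.
split=> [nsq|[[[|m] n_m] odd_n]|[[[|m] n_m] odd_n]].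
- apply: eq_mod; rewrite M_diff_Fp // big1 // => j _.
  by case: eqP => [n_j|]; rewrite ?mul0r //; case: nsq; exists j.+1.
- by rewrite n_m in n_gt0.
- apply: eq_mod; rewrite (square m n_m) -signr_odd.
  by move: odd_n; rewrite n_m oddX /= => /negPf->.
- by rewrite n_m in n_gt0.
(* Here [m] is odd, and -1 = 2 in F_3. *)
- apply: eq_mod; rewrite (square m n_m) -signr_odd.
  by move: odd_n; rewrite n_m oddX /= negbK => ->; apply/val_inj.
Qed.
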